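(* Let $\mathcal{C}$ be a finite family, with $|\mathcal{C}|\ge 4$, of compact convex sets in $\mathbb{R}^2$, all contained in the open unit disk, satisfying the $(4,3)$-property. If there exists $x\in\Delta\setminus(A_1\cup A_2\cup A_3\cup A_4)$, then $\tau(\mathcal{C})\le 8$.
   Context: The $(4,3)$-property: among every $4$ members of $\mathcal{C}$ some $3$ have a common point. $\tau(\mathcal{C})$ is the minimum number of points meeting every member of $\mathcal{C}$. $f(t)=(\cos 2\pi t,-\sin 2\pi t)$ for $t\in[0,1]$; $[a,b]$ is the segment with endpoints $a,b$. $\Delta=\{x\in\mathbb{R}^4: x_i\ge0,\ \sum x_i=1\}$. For $x\in\Delta$ and $1\le i\le4$, $R^i_x$ is the interior of the region bounded by the arc of the unit circle from $f(\sum_{j<i}x_j)$ to $f(\sum_{j\le i}x_j)$ (empty sum $=0$) and by the segments $[(1,0),f(x_1+x_2)]$ and $[f(x_1),f(x_1+x_2+x_3)]$ (the open piece of the disk cut by these two chords that is adjacent to the $i$-th arc; empty if $x_i=0$). $A_i$ is the set of $x\in\Delta$ for which there are $C_1,C_2,C_3\in\mathcal{C}$ with $C_1\cap C_2\cap C_3\neq\emptyset$ and $C_j\cap C_k\subset R^i_x$ for all $1\le j<k\le3$. *)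

(* Defs.v *)
From HB Require Import structures.
From mathcomp Require Import all_boot all_order all_algebra.
From mathcomp Require Import all_classical all_reals all_analysis.

Set Implicit Arguments.
Unset Strict Implicit.
Unset Printing Implicit Defensive.

Import Order.TTheory GRing.Theory Num.Theory.
Import numFieldNormedType.Exports.

Local Open Scope classical_set_scope.
Local Open Scope ring_scope.

(* The plane is R * R. Its library norm is the sup norm, so the Euclidean unit
   disk is written out in coordinates. *)
Definition open_disk (R : realType) : set (R * R) :=
  [set p | p.1 ^+ 2 + p.2 ^+ 2 < 1].
Arguments open_disk : clear implicits.

Definition segment (R : realType) (a b : R * R) : set (R * R) :=
  [set (1 - t) *: a + t *: b | t in `[0, 1]].

Definition pq_property (T : Type) (p q : nat) (C : set (set T)) : Prop :=
  forall D, D `<=` C -> (D #= `I_p)%card ->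
    exists E, [/\ E `<=` D, (E #= `I_q)%card & \bigcap_(X in E) X !=set0].

Definition pierces (T : Type) (P : set T) (C : set (set T)) : Prop :=
  forall X, C X -> X `&` P !=set0.

(* The value is +oo when no finite set of points meets every member. *)
Definition tau (R : realType) (T : Type) (C : set (set T)) : \bar R :=
  ereal_inf [set n%:R%:E | n in
    [set n : nat | exists2 P : set T, (P #= `I_n)%card & pierces P C]].
Arguments tau R {T} C.

Definition simplex (R : realType) : set 'rV[R]_4 :=
  [set x | (forall i, 0 <= x 0 i) /\ \sum_i x 0 i = 1].
Arguments simplex : clear implicits.

Definition f (R : realType) (t : R) : R * R :=
  (cos (2 * pi * t), - sin (2 * pi * t)).

Definition psum (R : realType) (x : 'rV[R]_4) (k : nat) : R :=
  \sum_(j < 4 | (j < k)%N) x 0 j.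

Definition arc (R : realType) (x : 'rV[R]_4) (i : 'I_4) : set (R * R) :=
  [set f t | t in `[psum x i, psum x i.+1]].

Definition chords (R : realType) (x : 'rV[R]_4) : set (R * R) :=
  segment (1, 0) (f (psum x 2)) `|` segment (f (psum x 1)) (f (psum x 3)).

(* The connected component of the open disk minus the two chords whose closure
   contains the i-th arc, with i counted from 0. The test 0 < x 0 i makes the
   piece empty when x 0 i = 0: the arc is then a single point, which can be
   adherent to components that belong to other arcs. *)
Definition region (R : realType) (x : 'rV[R]_4) (i : 'I_4) : set (R * R) :=
  [set p | [/\ 0 < x 0 i, (open_disk R `\` chords x) p
    & arc x i `<=` closure (connected_component (open_disk R `\` chords x) p)]].

Definition A_set (R : realType) (C : set (set (R * R))) (i : 'I_4) :
    set 'rV[R]_4 :=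
  [set x | simplex R x /\ exists C1 C2 C3,
    [/\ [/\ C C1, C C2 & C C3],
        [/\ C1 <> C2, C1 <> C3 & C2 <> C3],
        C1 `&` C2 `&` C3 !=set0
      & [/\ C1 `&` C2 `<=` region x i, C1 `&` C3 `<=` region x i
          & C2 `&` C3 `<=` region x i]]].

(* Main.v *)
(* The trace of a convex set on the two chords is a pair of intervals. If four
   members of C had pairwise disjoint traces, then three of them would have a
   common point, their pairwise intersections would avoid the chords, and
   connectedness would put these intersections in a single region, so that x
   would lie in some A_i. Hence at most three traces are pairwise disjoint, and
   Tardos' theorem on 2-intervals (transversal number at most twice the matching
   number) pierces the members that meet the chords. A member that misses the
   chords costs one point of its own but lowers the matching number of the other
   ones by one, so that six points suffice.

   Tardos' theorem is obtained as follows: k cut points on each track are moved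
   until the k + 1 gaps of a track all carry the same weight of unpierced
   members. This position exists by the Poincare-Miranda theorem, which follows
   from Kuhn's cubical lemma, proved by a parity argument (discrete Stokes). *)

Require Import Defs.
From HB Require Import structures.
From mathcomp Require Import all_boot all_order all_algebra.

Set Implicit Arguments.
Unset Strict Implicit.
Unset Printing Implicit Defensive.

Import Order.TTheory GRing.Theory Num.Theory.

(** * Kuhn's cubical lemma *)

Section Kuhn.
Variables n N : nat.
Let V := {ffun 'I_n -> 'I_N.+1}.
Definition kstep (j : 'I_n) (x : V) : V :=
  [ffun i => if i == j then inord (x i).+1 else x i].
Variable L : 'I_n -> V -> bool.

(* Parity of the number of lattice paths from x that use each direction of D at
   most once and whose m-th step changes the label with index l_m: the cup
   product of the coboundaries of these labels, summed over the simplices of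
   Kuhn's triangulation in the unit cell at x. *)
Fixpoint kcount (D : {set 'I_n}) (x : V) (l : seq 'I_n) : bool :=
  if l is i :: l' then
    \big[addb/false]_(j in D)
      ((L i (kstep j x) (+) L i x) && kcount (D :\ j) (kstep j x) l')
  else true.

Lemma kstepC i j x : kstep i (kstep j x) = kstep j (kstep i x).
Proof.
apply/ffunP => k; rewrite !ffunE.
by case: eqP => [->|]; case: eqP => // ->.
Qed.

(** An unordered pair contributes both [F i j] and [F j i], which cancel modulo 2. *)
Lemma addb_sym_sum (D : {set 'I_n}) (F : 'I_n -> 'I_n -> bool) :
  (forall i j, F i j = F j i) ->
  \big[addb/false]_(i in D) \big[addb/false]_(j in D :\ i) F i j = false.
Proof.
move=> Fs.
have E : \big[addb/false]_(i in D) \big[addb/false]_(j in D :\ i) F i j =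
  \big[addb/false]_(i in D) \big[addb/false]_(j in D | (i < j)%N) F i j (+)
  \big[addb/false]_(i in D) \big[addb/false]_(j in D | (j < i)%N) F i j.
  rewrite -big_split /=; apply: eq_bigr => i _.
  rewrite (bigID (fun j : 'I_n => (i < j)%N)) /=; congr (_ (+) _);
    apply: eq_bigl => j; rewrite !inE -val_eqE /=; case: ltngtP; rewrite ?andbT ?andbF //.
rewrite E [X in _ (+) X](exchange_big_dep (mem D)) /=; last by move=> i j _ /andP[].
apply: (canLR (addbK _)); rewrite addFb; apply: eq_bigr => j jD.
by apply: eq_big => i => [|_]; rewrite ?jD // Fs.
Qed.

(* The coboundaries are closed, so the unused step can be moved from the
   beginning of the path to its end: each exchange of two neighbouring steps
   leaves a sum that is symmetric in both directions, hence even. *)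
Lemma kcount_shift (D : {set 'I_n}) x l :
  \big[addb/false]_(j in D) kcount (D :\ j) (kstep j x) l =
  \big[addb/false]_(j in D) kcount (D :\ j) x l.
Proof.
elim: l D x => [//|i l IH] D x /=.
have sw (a b : 'I_n) : (a \in D) && (b \in D :\ a) = (b \in D) && (a \in D :\ b).
  by rewrite !inE eq_sym; case: (a \in D); case: (b \in D); rewrite ?andbF.
transitivity (\big[addb/false]_(a in D) \big[addb/false]_(b in D :\ a)
   ((L i (kstep a x) (+) L i x) && kcount (D :\ a :\ b) (kstep b (kstep a x)) l)).
  have addb_false (a b : bool) : a (+) b = false -> a = b by case: a b => -[].
  apply: addb_false; rewrite -big_split /=.
  under eq_bigr do rewrite -big_split /=.
  rewrite -[RHS](@addb_sym_sum D (fun a b =>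
    (L i (kstep b (kstep a x)) (+) L i x) && kcount (D :\ a :\ b) (kstep b (kstep a x)) l)).
    by apply: eq_bigr => a _; apply: eq_bigr => b _; case: (kcount _ _ _);
      rewrite ?andbF // !andbT; do 3 case: (L i _).
  by move=> a b; rewrite kstepC setDDl [_ :|: _]setUC -setDDl.
under eq_bigr => a _.
  rewrite -big_distrr /= IH big_distrr /=.
  over.
rewrite (exchange_big_dep (mem D)) /=; last by move=> a b _; rewrite inE => /andP[].
apply: eq_bigr => b bD; apply: eq_big => a.
  by rewrite [LHS]sw bD.
by move=> _; rewrite setDDl setUC -setDDl.
Qed.


Hypothesis N_gt0 : (0 < N)%N.

(* Corners of the unit cells of the face of the grid where the coordinates
   outside D are equal to N. *)
Definition kbox (D : {set 'I_n}) (x : V) :=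
  [forall i, if i \in D then (x i < N)%N else x i == N :> nat].

(** The layers [0 < x j < N] occur in both sums on the left and cancel modulo 2. The layer [x j = N]
    is [kbox (D :\ j)]. *)
Lemma kbox_telescope (D : {set 'I_n}) j (F : V -> bool) : j \in D ->
  \big[addb/false]_(x | kbox D x) F (kstep j x) (+) \big[addb/false]_(x | kbox D x) F x =
  \big[addb/false]_(x | kbox (D :\ j) x) F x
  (+) \big[addb/false]_(x | kbox D x && (x j == 0 :> nat)) F x.
Proof.
move=> jD.
pose Q (x : V) := [forall i, (i != j) ==> (if i \in D then (x i < N)%N else x i == N :> nat)].
have boxD x : kbox D x = Q x && (x j < N)%N.
  apply/forallP/andP => [h|[/forallP h hj] i].
    split; last by have := h j; rewrite jD.
    by apply/forallP => i; apply/implyP => _.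
  by have [->|ij] := eqVneq i j; [rewrite jD | exact: (implyP (h i))].
have boxDj x : kbox (D :\ j) x = Q x && (x j == N :> nat).
  apply/forallP/andP => [h|[/forallP h hj] i].
    split; last by have := h j; rewrite !inE eqxx.
    by apply/forallP => i; apply/implyP => ij; have := h i; rewrite !inE ij.
  by rewrite !inE; have [->//|ij] := eqVneq i j; exact: (implyP (h i)).
pose back (x : V) : V := [ffun i => if i == j then inord (x i).-1 else x i].
have Qs x : Q (kstep j x) = Q x.
  by apply/eq_forallb => i; rewrite !ffunE; case: eqP.
have -> : \big[addb/false]_(x | kbox D x) F (kstep j x) =
    \big[addb/false]_(x | Q x && (0 < x j)%N) F x.
  rewrite [RHS](reindex_onto (kstep j) back) /=; last first.
    move=> x /andP[_ xj]; apply/ffunP => i; rewrite !ffunE.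
    case: eqP => [->|//]; apply: val_inj.
    have xb : ((x j).-1 < N.+1)%N := leq_ltn_trans (leq_pred _) (ltn_ord _).
    by rewrite /= (inordK xb) prednK // inordK.
  apply: eq_bigl => x; rewrite Qs boxD ffunE eqxx -andbA; congr (_ && _).
  apply/idP/andP => [xN|[x0 _]].
    rewrite inordK //; split=> //; apply/eqP/ffunP => i; rewrite !ffunE.
    by case: eqP => [->|//]; apply: val_inj; rewrite /= (@inordK N (x j).+1) //= inordK.
  (* Out of range [inord] returns 0, so a positive coordinate after the step forces [x j < N]. *)
  by move: x0; rewrite /inord val_insubd ltnS; case: (x j < N)%N.
pose mid (x : V) := [&& Q x, (0 < x j)%N & (x j < N)%N].
have -> : \big[addb/false]_(x | Q x && (0 < x j)%N) F x =
    \big[addb/false]_(x | mid x) F x (+) \big[addb/false]_(x | kbox (D :\ j) x) F x.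
  rewrite (bigID (fun x : V => (x j < N)%N)) /=.
  congr (_ (+) _); apply: eq_bigl => x; first by rewrite -andbA.
  rewrite boxDj -leqNgt -andbA; congr (_ && _).
  rewrite eqn_leq -[(x j <= N)%N]ltnS ltn_ord /=.
  by case: (leqP N (x j)) => [h|]; rewrite ?andbF // (leq_trans N_gt0).
rewrite [X in _ (+) X = _](bigID (fun x : V => (x j == 0 :> nat))) /=.
have -> : \big[addb/false]_(x | kbox D x && (x j != 0 :> nat)) F x =
    \big[addb/false]_(x | mid x) F x.
  by apply: eq_bigl => x; rewrite boxD /mid lt0n -andbA; congr (_ && _); rewrite andbC.
by do 3 case: (\big[_/_]_(x | _) F x).
Qed.

Hypothesis L_lo : forall i (x : V), x i = 0 :> nat -> L i x = false.
Hypothesis L_hi : forall i (x : V), x i = N :> nat -> L i x = true.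

(** A path that avoids direction [j] stays in the face, where the label [j] is constant, so no step
    can change it. *)
Lemma kcount_face (D : {set 'I_n}) (x : V) l j : j \in l -> j \notin D ->
  (x j = 0 :> nat \/ x j = N :> nat) -> kcount D x l = false.
Proof.
move=> + + xj; elim: l D x xj => //= i l IH D x xj; rewrite inE => jl jD.
apply: big1 => k kD.
have kjx : kstep k x j = x j.
  by rewrite ffunE; case: eqP => // jk; move: jD; rewrite jk kD.
have [jE|ji] := eqVneq j i; last first.
  rewrite IH ?andbF ?kjx //; first by move: jl; rewrite (negbTE ji).
  by rewrite !inE (negbTE jD) andbF.
subst i; case: xj => xj; first by rewrite !L_lo ?kjx.
by rewrite !L_hi ?kjx.
Qed.

(** Discrete Stokes: the sum over the cells reduces to boundary faces, and only the face [x i = N]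
    of the first label [i] survives. Induction applies to that face. *)
Lemma kcount_total (l : seq 'I_n) : uniq l ->
  \big[addb/false]_(x | kbox [set i in l] x) kcount [set i in l] x l = true.
Proof.
elim: l => [_|i l IH /= /andP[il ul]].
  rewrite (big_pred1 [ffun=> ord_max]) //= => x.
  apply/forallP/eqP => [h|-> i]; last by rewrite !inE ffunE /=.
  by apply/ffunP => i; apply: val_inj; have := h i; rewrite !inE ffunE => /eqP.
set D := [set j in i :: l].
have Di : D :\ i = [set j in l].
  by apply/setP => j; rewrite !inE; have [->|] := eqVneq j i; rewrite ?(negbTE il).
(* By [kcount_shift] the count at [x] is the sum over [j] of the differences of [th j] in direction
   [j], which telescope. *)
pose th j (y : V) := L i y && kcount (D :\ j) y l.
transitivity (\big[addb/false]_(x | kbox D x)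
  \big[addb/false]_(j in D) (th j (kstep j x) (+) th j x)).
  apply: eq_bigr => x _; rewrite [RHS]big_split /= -[X in _ (+) X]big_distrr /= -kcount_shift.
  rewrite big_distrr -big_split /=; apply: eq_bigr => j _.
  by rewrite /th andb_addl.
rewrite exchange_big /=.
rewrite (eq_bigr (fun j => \big[addb/false]_(x | kbox (D :\ j) x) th j x
  (+) \big[addb/false]_(x | kbox D x && (x j == 0 :> nat)) th j x)); last first.
  by move=> j jD; rewrite -kbox_telescope // -big_split.
rewrite (bigD1 i) ?inE ?eqxx //= Di.
have -> : \big[addb/false]_(x | kbox [set j in l] x) th i x = true.
  rewrite -IH //; apply: eq_bigr => x /forallP bx; move: (bx i).
  by rewrite !inE (negbTE il) /th Di => /eqP xN; rewrite L_hi.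
rewrite [X in true (+) X]big1; last by move=> x /andP[_ /eqP x0]; rewrite /th L_lo.
(* A direction [j] other than [i] is a label of [l], so [kcount_face] kills both of its faces. *)
rewrite big1 // => j; rewrite !inE => /andP[/orP[/eqP->|jl] ji]; first by rewrite eqxx in ji.
have Dj : j \notin D :\ j by rewrite !inE eqxx.
rewrite !big1 // => x.
  by move=> /andP[_ /eqP x0]; rewrite /th (@kcount_face _ _ _ j) ?andbF //; left.
move=> /forallP bx; move: (bx j); rewrite !inE eqxx /= => /eqP xN.
by rewrite /th (@kcount_face _ _ _ j) ?andbF //; right.
Qed.

(** A counted path changes the label [i] at one of its steps, and it uses each direction at most
    once, so it stays in the unit cell at [x]. *)
Lemma kcount_cell (D : {set 'I_n}) (x : V) l i : (forall k, k \in D -> (x k < N)%N) ->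
  kcount D x l -> i \in l ->
  exists y z : V, [/\ forall k, (x k <= y k <= x k + (k \in D))%N,
    forall k, (x k <= z k <= x k + (k \in D))%N & L i y != L i z].
Proof.
elim: l D x => //= i0 l IH D x xN + il.
have [j /andP[jD /andP[Lj cj]] _|h] := pickP (fun j => (j \in D) &&
    ((L i0 (kstep j x) (+) L i0 x) && kcount (D :\ j) (kstep j x) l)); last first.
  by rewrite big1 // => j jD; have := h j; rewrite jD.
have sj k : kstep j x k = (x k + (k == j))%N :> nat.
  rewrite ffunE; case: eqP => [->|_]; last by rewrite addn0.
  by rewrite inordK ?addn1 // ltnS xN.
have [ii0|ii0] := eqVneq i i0.
  exists (kstep j x), x; split=> [k|k|].
  - rewrite sj leq_addr leq_add2l; have [->|//] := eqVneq k j.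
    by rewrite jD.
  - by rewrite leqnn leq_addr.
  - by rewrite ii0; move: Lj; do 2 case: (L i0 _).
move: il; rewrite inE (negbTE ii0) /= => il.
have [k|y [z [hy hz yz]]] := IH _ _ _ cj il.
  by rewrite !inE => /andP[kj kD]; rewrite sj (negbTE kj) addn0 xN.
have w (v : V) : (forall k, (kstep j x k <= v k <= kstep j x k + (k \in D :\ j))%N) ->
    forall k, (x k <= v k <= x k + (k \in D))%N.
  move=> hv k; have := hv k; rewrite sj !inE; have [->|kj] := eqVneq k j.
    by rewrite jD /= addn0 => /andP[/(leq_trans (leq_addr _ _))-> ->].
  by rewrite addn0.
by exists y, z; split=> //; exact: w.
Qed.

(** The odd total forces a cell with an odd count. *)
Lemma kuhn : exists x : V, (forall i, (x i < N)%N) /\ forall i,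
  exists y z : V, [/\ forall k, (x k <= y k <= (x k).+1)%N,
    forall k, (x k <= z k <= (x k).+1)%N & L i y != L i z].
Proof.
have := kcount_total (enum_uniq 'I_n).
have [x /andP[/forallP bx cx] _|h] :=
  pickP (fun x => kbox [set i in enum 'I_n] x && kcount [set i in enum 'I_n] x (enum 'I_n)).
  have xN i : (x i < N)%N by have := bx i; rewrite !inE mem_enum.
  exists x; split=> // i.
  have [k|//|y [z [hy hz yz]]] := kcount_cell _ cx (_ : i \in _); rewrite ?mem_enum //.
  by exists y, z; split=> // k; [have := hy k|have := hz k]; rewrite !inE mem_enum addn1.
by rewrite big1 // => x bx; have := h x; rewrite bx.
Qed.
End Kuhn.

(** * Hall's marriage theorem *)

Definition nbhd (A B : finType) (e : A -> B -> bool) (S : {set A}) : {set B} :=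
  [set b | [exists a in S, e a b]].

Lemma nbhdU (A B : finType) (e : A -> B -> bool) (S T : {set A}) :
  nbhd e (S :|: T) = nbhd e S :|: nbhd e T.
Proof.
apply/setP => b; rewrite !inE; apply/existsP/orP.
  by case=> a /andP[]; rewrite inE => /orP[] aS eab; [left|right];
    apply/existsP; exists a; rewrite aS.
by case=> /existsP[a /andP[aS eab]]; exists a; rewrite inE aS ?orbT.
Qed.

Lemma nbhd_avoid (A B : finType) (e : A -> B -> bool) (S : {set A}) (T : {set B}) :
  nbhd (fun a b => e a b && (b \notin T)) S = nbhd e S :\: T.
Proof.
apply/setP => b; rewrite !inE; apply/existsP/andP.
  by case=> a /and3P[aS eab bT]; split=> //; apply/existsP; exists a; rewrite aS.
by case=> bT /existsP[a /andP[aS eab]]; exists a; rewrite aS eab.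
Qed.

(** Induction on [#|A0|], following Halmos and Vaughan. *)
Lemma hall (A B : finType) (b0 : B) (e : A -> B -> bool) (A0 : {set A}) :
  (forall S : {set A}, S \subset A0 -> (#|S| <= #|nbhd e S|)%N) ->
  exists2 g : A -> B, {in A0 &, injective g} & {in A0, forall a, e a (g a)}.
Proof.
have [m] := ubnP #|A0|; elim: m A0 e => // m IH A0 e; rewrite ltnS => Am hS.
have [A00|[a aA]] := set_0Vmem A0.
  by exists (fun=> b0) => [a b|a]; rewrite A00 inE.
(* Both cases match some [S] into some [T] so that Hall's condition survives on the rest of [A0]
   once [T] is removed. *)
suff [S [T [g [S0 SA ginj gE hT]]]] : exists (S : {set A}) (T : {set B}) (g : A -> B),
   [/\ S != set0, S \subset A0, {in S &, injective g},
     {in S, forall a, e a (g a) && (g a \in T)}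
   & forall U : {set A}, U \subset A0 :\: S -> (#|U| <= #|nbhd e U :\: T|)%N].
  have [|U US|g2 g2inj g2E] := IH (A0 :\: S) (fun a b => e a b && (b \notin T)).
  - apply: leq_trans Am; rewrite proper_card // properEneq subsetDl andbT.
    apply: contraNneq S0 => /setP AS; apply/eqP/setP => x; rewrite !inE.
    have := AS x; rewrite !inE; case xS: (x \in S) => //=.
    by rewrite (subsetP SA).
  - by rewrite nbhd_avoid hT.
  have g2E' x : x \in A0 -> x \notin S -> e x (g2 x) && (g2 x \notin T).
    by move=> xA xS; apply: g2E; rewrite inE xS.
  exists (fun x => if x \in S then g x else g2 x) => [x y xA yA|x xA] /=; last first.
    by case: ifPn => [/gE/andP[]//|xS]; have /andP[] := g2E' _ xA xS.
  case: ifPn => xS; case: ifPn => yS; first exact: ginj.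
  - move=> gg; have /andP[_] := g2E' _ yA yS; rewrite -gg.
    by have /andP[_ ->] := gE _ xS.
  - move=> gg; have /andP[_] := g2E' _ xA xS; rewrite gg.
    by have /andP[_ ->] := gE _ yS.
  - by apply: g2inj; rewrite inE ?xS ?yS.
(* A tight proper subset is matched inside its own neighbourhood by induction. *)
have [S /and3P[S0 SA St]|hlt] :=
    pickP (fun S : {set A} => [&& S != set0, S \proper A0 & #|nbhd e S| <= #|S|]%N).
  have [|U US|g ginj gE] := IH S e.
  - exact: leq_trans (proper_card SA) Am.
  - by rewrite hS // (subset_trans US) ?proper_sub.
  exists S, (nbhd e S), g; split; rewrite ?proper_sub //.
    move=> x xS; rewrite gE //= inE; apply/existsP; exists x; rewrite xS.
    exact: gE.
  move=> U US.
  (* Tightness of [S] is subtracted from Hall's condition for [U :|: S]. *)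
  have := hS (U :|: S); rewrite subUset (subset_trans US) ?subsetDl ?proper_sub //= => /(_ isT).
  rewrite nbhdU cardsU -(cardsID (nbhd e S) (_ :|: _)) (setIidPr (subsetUr _ _)).
  rewrite setDUl setDv setU0 => le.
  have := leq_trans le (leq_add St (leqnn _)).
  have -> : U :&: S = set0.
    apply/setP => x; rewrite !inE; apply/andP => -[/(subsetP US)].
    by rewrite !inE => /andP[/negbTE->].
  by rewrite cards0 subn0 addnC leq_add2l.
(* Otherwise every nonempty proper subset has a neighbour to spare, so any edge at [a] may be
   used. *)
have [b eab] : exists b, e a b.
  have := hS [set a]; rewrite sub1set aA cards1 => /(_ isT) /card_gt0P[b].
  by rewrite inE => /existsP[x /andP[/set1P->]]; exists b.
exists [set a], [set b], (fun=> b); split; rewrite ?sub1set //.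
- by apply/set0Pn; exists a; rewrite set11.
- by move=> x y /set1P-> /set1P->.
- by move=> x /set1P->; rewrite eab set11.
move=> U US; have [->|U0] := eqVneq U set0; first by rewrite cards0.
have := hlt U; rewrite U0 properE (subset_trans US) ?subsetDl //=.
have -> /= : ~~ (A0 \subset U).
  by apply/subsetPn; exists a => //; apply/negP => /(subsetP US); rewrite !inE eqxx.
move=> /negbT; rewrite -ltnNge => lt.
by rewrite -ltnS (leq_trans lt) // (cardsD1 b (nbhd e U)); case: (_ \in _).
Qed.

Local Open Scope ring_scope.

(** The support satisfies Hall's condition: the rows in [S] carry weight [s *+ #|S|], all of it
    within the columns in [T], whose weight is [s *+ #|T|]. *)
Lemma balanced_matrix_perm (R : realFieldType) (n : nat) (w : 'M[R]_n.+1) (s : R) :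
  0 < s -> (forall i j, 0 <= w i j) ->
  (forall i, \sum_j w i j = s) -> (forall j, \sum_i w i j = s) ->
  exists2 g : 'I_n.+1 -> 'I_n.+1, injective g & forall i, 0 < w i (g i).
Proof.
move=> s_gt0 w_ge0 rowE colE.
have [S _|g ginj gE] := @hall _ _ ord0 (fun i j => 0 < w i j) [set: 'I_n.+1]; last first.
  exists g; last by move=> i; apply: gE; rewrite inE.
  by move=> i j; apply: ginj; rewrite inE.
set T := nbhd _ S.
have : s *+ #|S| <= s *+ #|T|.
  rewrite -!sumr_const.
  have -> : \sum_(i in S) s = \sum_(i in S) \sum_(j in T) w i j.
    apply: eq_bigr => i iS; rewrite -(rowE i) [LHS](bigID (mem T)) /= [X in _ + X]big1 ?addr0 //.
    move=> j; apply: contraNeq => wij; rewrite inE; apply/existsP; exists i.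
    by rewrite iS lt_def wij w_ge0.
  rewrite exchange_big /=; apply: ler_sum => j _.
  by rewrite -(colE j) [leRHS](bigID (mem S)) /= lerDl sumr_ge0.
by rewrite ler_pMn2l.
Qed.

From mathcomp Require Import all_classical all_reals all_analysis.
From mathcomp Require Import ring lra.
Import numFieldNormedType.Exports.
Local Open Scope classical_set_scope.
Local Open Scope ring_scope.

(** * The Poincare-Miranda theorem *)

Definition cube (R : realType) n : set 'rV[R]_n := [set v | forall j, 0 <= v 0 j <= 1].
Arguments cube : clear implicits.

Section PM.
Variables (R : realType) (n : nat) (F : 'I_n -> 'rV[R]_n -> R).
Hypothesis F_cont : forall i, continuous (F i).
Hypothesis F_lo : forall i v, cube R n v -> v 0 i = 0 -> F i v <= 0.
Hypothesis F_hi : forall i v, cube R n v -> v 0 i = 1 -> 0 <= F i v.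

(** Kuhn's lemma is applied to the grid of mesh [m.+1%:R^-1], labelled by the sign of [F i]. *)
Lemma kuhn_approx (m : nat) : exists u, cube R n u /\ forall i, exists a b : 'rV[R]_n,
  [/\ forall j, `|u 0 j - a 0 j| <= m.+1%:R^-1,
      forall j, `|u 0 j - b 0 j| <= m.+1%:R^-1, F i a <= 0 & 0 <= F i b].
Proof.
have m0 : 0 < m.+1%:R :> R by rewrite ltr0n.
pose pt (x : {ffun 'I_n -> 'I_m.+2}) : 'rV[R]_n := \row_j ((x j)%:R / m.+1%:R).
have cube_pt x : cube R n (pt x).
  move=> j; rewrite mxE divr_ge0 ?ler0n //= ler_pdivrMr // mul1r ler_nat.
  by rewrite -ltnS ltn_ord.
(* Labels are imposed on the two faces of direction [i], because the sign of [F i] is only weakly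
   known there. *)
pose L i (x : {ffun 'I_n -> 'I_m.+2}) :=
  (x i == m.+1 :> nat) || (x i != 0 :> nat) && (0 < F i (pt x)).
have [|i x xi|i x xi|x [xN hx]] := @kuhn n m.+1 L; first by [].
- by rewrite /L xi.
- by rewrite /L xi eqxx.
exists (pt x); split=> // i; have [y [z [hy hz yz]]] := hx i.
have near_pt (y' : {ffun 'I_n -> 'I_m.+2}) :
    (forall k, (x k <= y' k <= (x k).+1)%N) ->
    forall j, `|(pt x) 0 j - (pt y') 0 j| <= m.+1%:R^-1.
  move=> h j; rewrite !mxE -mulrBl normrM [`|_^-1|]gtr0_norm ?invr_gt0 //.
  rewrite ler_piMl ?invr_ge0 ?ler0n // distrC.
  have /andP[h1 h2] := h j; rewrite -natrB // normr_nat lern1.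
  by rewrite leq_subLR addn1.
have Lpos y' : L i y' -> 0 <= F i (pt y').
  case/orP => [/eqP e|/andP[_ /ltW//]]; apply: F_hi => //.
  by rewrite mxE e divff // gt_eqF.
have Lneg y' : ~~ L i y' -> F i (pt y') <= 0.
  rewrite negb_or negb_and negbK -leNgt => /andP[_ /orP[/eqP e|//]]; apply: F_lo => //.
  by rewrite mxE e mul0r.
case Ly : (L i y) yz => yz.
  exists (pt z), (pt y); split; [exact: near_pt|exact: near_pt| |exact: Lpos].
  by apply: Lneg; case: (L i z) yz.
exists (pt y), (pt z); split; [exact: near_pt|exact: near_pt| |].
  by apply: Lneg; rewrite Ly.
by apply: Lpos; case: (L i z) yz.
Qed.

(** Near a cluster point of the approximate zeros [F i] takes values of both weak signs, so by
    continuity it vanishes there. *)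
Lemma poincare_miranda : exists2 v, cube R n v & forall i, F i v = 0.
Proof.
have [u hu] := choice kuhn_approx.
have cC : compact (cube R n).
  have := @rV_compact R n (fun=> `[0%R, 1%R]%classic) (fun=> @segment_compact R 0 1).
  by congr compact; apply/seteqP; split=> v /= h j; have := h j; rewrite /= in_itv.
have [v [vC vcl]] := cC (u @ \oo) _ (filterE _ (fun m => (hu m).1)).
exists v => // i.
have key (P : set R) : nbhs (F i v) P ->
    exists a b, [/\ P (F i a), P (F i b), F i a <= 0 & 0 <= F i b].
  move=> /F_cont /nbhs_ballP[e /= e0 He].
  have e2 : 0 < e / 2 by rewrite divr_gt0.
  have [M _ HM] := near_infty_natSinv_lt (PosNum e2).
  have ev : (u @ \oo) (u @` [set m | (M <= m)%N]) by exists M => // m /= Mm; exists m.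
  have [_ [[m Mm <-] um]] := vcl _ _ ev (nbhsx_ballx v _ e2).
  have [_ /(_ i)[a [b [ha hb Fa Fb]]]] := hu m.
  have near_v (a' : 'rV[R]_n) : (forall j, `|u m 0 j - a' 0 j| <= m.+1%:R^-1) -> ball v e a'.
    move=> h; split=> // i0 j; rewrite ord1 /ball /=; have := um.2 0 j; rewrite /ball /= => h1.
    have -> : v 0 j - a' 0 j = (v 0 j - u m 0 j) + (u m 0 j - a' 0 j) by rewrite addrA subrK.
    rewrite (splitr e) (le_lt_trans (ler_normD _ _)) // ltrD // (le_lt_trans (h j)) //.
    exact: HM.
  by exists a, b; split=> //; apply: He; apply: near_v.
apply/eqP; rewrite eq_le !leNgt; apply/andP; split; apply/negP => F0.
- have [a [b [h _ h' _]]] := key [set y | 0 < y] (lt_nbhsr F0).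
  by have := le_lt_trans h' h; rewrite ltxx.
- have [a [b [_ h _ h']]] := key [set y | y < 0] (lt_nbhsl F0).
  by have := le_lt_trans h' h; rewrite ltxx.
Qed.
End PM.

(** * Piercing 2-intervals *)

Section Cuts.
Variable R : realType.
Implicit Types (c : nat -> R) (A B : set R).

(* Stick breaking: c i = 0 makes the gap between cut i and cut i.+1 empty, and
   c i = 1 makes all later gaps empty. *)
Fixpoint cut c j : R :=
  if j is j'.+1 then cut c j' + c j' * (1 - cut c j') else 0.

(* Positive exactly when A lies strictly inside the i-th gap. An empty A counts
   as lying inside every nonempty gap, since no cut point can pierce it. *)
Definition depth A c i : R :=
  if A == set0 then cut c i.+1 - cut c i
  else Num.max 0 (Num.min (inf A - cut c i) (cut c i.+1 - sup A)).

(** The guard excludes the empty set, whose [inf] and [sup] are default values. The strict bounds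
    keep [A] away from the fixed ends 0 and 1 of the track. *)
Definition segment01 A := A !=set0 ->
  [/\ 0 < inf A, sup A < 1 & forall y, A y <-> inf A <= y <= sup A].

Section Fixed.
Variable c : nat -> R.
Hypothesis c01 : forall j, 0 <= c j <= 1.

Lemma cut01 j : 0 <= cut c j <= 1.
Proof. by elim: j => [|j IH] /=; [rewrite lexx ler01|have := c01 j; nra]. Qed.

Lemma cut_le i j : (i <= j)%N -> cut c i <= cut c j.
Proof.
move=> /subnK <-; elim: (j - i)%N => //= m IH.
by have := cut01 (m + i); have := c01 (m + i); nra.
Qed.

Lemma cut_eq1 i j : c i = 1 -> (i < j)%N -> cut c j = 1.
Proof.
move=> ci /cut_le /=; rewrite ci mul1r addrC subrK => le.
by apply/eqP; rewrite eq_le le; have /andP[_ ->] := cut01 j.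
Qed.

Lemma depth_ge0 A i : 0 <= depth A c i.
Proof.
rewrite /depth; case: ifP => _; first by rewrite subr_ge0 cut_le.
by rewrite le_max lexx.
Qed.

Lemma segment01_le A : segment01 A -> A !=set0 -> inf A <= sup A.
Proof. by move=> h A0; have [y Ay] := A0; have [_ _ /(_ y)[/(_ Ay)]] := h A0; lra. Qed.

Lemma depth_degenerate A i : segment01 A -> cut c i.+1 = cut c i -> depth A c i = 0.
Proof.
move=> hA e; rewrite /depth; case: ifPn => [_|/set0P A0]; first by rewrite e subrr.
apply/max_idPl; rewrite ge_min e; have := segment01_le hA A0.
by case: (leP (inf A - cut c i) 0) => //=; lra.
Qed.

Lemma depth_lo A i : segment01 A -> c i = 0 -> depth A c i = 0.
Proof. by move=> hA ci; apply: depth_degenerate => //=; rewrite ci mul0r addr0. Qed.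

Lemma depth_hi A i j : segment01 A -> c i = 1 -> (i < j)%N -> depth A c j = 0.
Proof.
move=> hA ci ij; apply: depth_degenerate => //.
by rewrite !(cut_eq1 ci) // ltnW.
Qed.

Lemma depth_gt0 A i y : segment01 A -> 0 < depth A c i -> A y -> cut c i < y < cut c i.+1.
Proof.
move=> hA; rewrite /depth => + Ay; have A0 : A !=set0 by exists y.
case: ifPn => [/eqP AE|_]; first by rewrite AE in Ay.
have [_ _ /(_ y)[/(_ Ay)]] := hA A0.
by rewrite lt_max ltxx /= lt_min => + _; lra.
Qed.

(** A point lies in at most one open gap. *)
Lemma depth_disjoint A B i j y : segment01 A -> segment01 B ->
  0 < depth A c i -> 0 < depth B c j -> A y -> B y -> i = j.
Proof.
move=> hA hB di dj /(depth_gt0 hA di) yi /(depth_gt0 hB dj) yj.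
by case: (ltngtP i j) => // /cut_le le; exfalso; move: le yi yj => /=; lra.
Qed.

Lemma depth_pierced A k : segment01 A -> c k = 1 ->
  (forall i, (i <= k)%N -> depth A c i = 0) ->
  exists2 j, (j < k)%N & A (cut c j.+1).
Proof.
move=> hA ck h; have [A0|A0] := eqVneq A set0.
  (* For empty [A] the depths are the gap lengths, which add up to 1 and cannot all vanish. *)
  have : \sum_(0 <= i < k.+1) (cut c i.+1 - cut c i) = 1.
    by rewrite telescope_sumr // (cut_eq1 ck) // subr0.
  rewrite big_nat big1 => [|i /andP[_ /h]]; last by rewrite /depth A0 eqxx.
  by move=> /eqP; rewrite eq_sym oner_eq0.
have /set0P/hA[inf0 sup1 AE] := A0.
have le_is : inf A <= sup A by apply: segment01_le => //; exact/set0P.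
(* Gap [j] is the one that [inf A] falls into. Zero depth there puts the next cut in [A], and
   [j = k] is impossible because the cut [k.+1] is 1. *)
have [j jP jmax] : exists2 j, (j <= k)%N && (cut c j < inf A) & inf A <= cut c j.+1.
  have : exists j, (j <= k)%N && (inf A <= cut c j.+1).
    by exists k; rewrite leqnn (cut_eq1 ck) //; lra.
  move=> /ex_minnP[j /andP[jk jI] jmin]; exists j => //; rewrite jk ltNge.
  apply/negP; case: j jk jI jmin => [|j] jk jI jmin /=; first by rewrite leNgt inf0.
  by move=> jI'; have := jmin j; rewrite jI' (ltnW jk) ltnn => /(_ isT).
have /andP[jk lt_j] := jP.
have jA : A (cut c j.+1).
  apply/AE; rewrite jmax /= leNgt; apply/negP => lt_s.
  have := h j jk; rewrite /depth (negbTE A0); apply/eqP; rewrite gt_eqF //.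
  by rewrite lt_max lt_min !subr_gt0 lt_j lt_s orbT.
exists j => //; rewrite ltn_neqAle jk andbT; apply/eqP => jE.
by move: jA => /AE; rewrite jE (cut_eq1 ck) //; lra.
Qed.
End Fixed.

Lemma continuous_depth (V : topologicalType) (C : V -> nat -> R) A i :
  (forall j, continuous (C ^~ j)) -> continuous (fun v => depth A (C v) i).
Proof.
move=> Cc.
have cc j : continuous (fun v => cut (C v) j).
  elim: j => [|j IH] v /=; first exact: cvg_cst.
  apply: cvgD; first exact: IH.
  by apply: cvgM; [exact: Cc|apply: cvgB; [exact: cvg_cst|exact: IH]].
rewrite /depth; case: (A == set0) => v; first by apply: cvgB; [exact: (cc i.+1)|exact: (cc i)].
apply: (@continuous_max _ _ (fun=> 0)
  (fun v => Num.min (inf A - cut (C v) i) (cut (C v) i.+1 - sup A))).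
  exact: cvg_cst.
apply: (@continuous_min _ _ (fun v => inf A - cut (C v) i) (fun v => cut (C v) i.+1 - sup A)).
  by apply: cvgB; [exact: cvg_cst|exact: (cc i)].
by apply: cvgB; [exact: (cc i.+1)|exact: cvg_cst].
Qed.
End Cuts.

Lemma continuous_sum (R : realType) (V : topologicalType) (A : finType) (f : A -> V -> R) :
  (forall a, continuous (f a)) -> continuous (fun v => \sum_a f a v).
Proof.
move=> fc; apply: continuous_big => [|a _]; last exact: fc.
by move=> x; exact: add_continuous.
Qed.

(** * Tardos' theorem for two tracks *)

Section TwoTrack.
Variables (R : realType) (k : nat) (T : finType) (I J : T -> set R).
Hypothesis I01 : forall t, segment01 (I t).
Hypothesis J01 : forall t, segment01 (J t).
Hypothesis IJ0 : forall t, I t !=set0 \/ J t !=set0.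
Hypothesis indep : forall g : 'I_k.+1 -> T, injective g ->
  exists i j, i != j /\ (I (g i) `&` I (g j) !=set0 \/ J (g i) `&` J (g j) !=set0).

(** The default 1 beyond the [k] free parameters places cut [k.+1] at 1, which leaves [k.+1]
    gaps. *)
Definition rates (e : 'I_k -> 'I_(k + k)) (v : 'rV[R]_(k + k)) (j : nat) : R :=
  if insub j is Some i then v 0 (e i) else 1.

Lemma rates_last e v : rates e v k = 1.
Proof. by rewrite /rates insubF ?ltnn. Qed.

Lemma rates_ord e v (i : 'I_k) : rates e v i = v 0 (e i).
Proof. by rewrite /rates valK. Qed.

Lemma rates01 e v : cube R _ v -> forall j, 0 <= rates e v j <= 1.
Proof. by move=> vC j; rewrite /rates; case: insub => [i|]; [exact: vC|rewrite ler01 /=]. Qed.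

Lemma continuous_rates e j : continuous (fun v => rates e v j).
Proof.
rewrite /rates; case: insub => [i|] /=; last exact: cst_continuous.
exact: coord_continuous.
Qed.

(* The parameters of the cut points are chosen, by Poincare-Miranda, such that
   the weights of all gaps of a track agree. Positive weights then give, by
   Hall, a bijection between the gaps of the two tracks, hence k + 1 members
   with pairwise disjoint traces. So all weights vanish, and every member is
   pierced. *)
Theorem two_track : exists p q : 'I_k -> R, forall t,
  (exists i, I t (p i)) \/ (exists i, J t (q i)).
Proof.
pose c := rates (@lshift k k); pose d := rates (@rshift k k).
pose w v i j := \sum_t depth (I t) (c v) i * depth (J t) (d v) j.
pose row v i := \sum_(j < k.+1) w v i j.
pose col v j := \sum_(i < k.+1) w v i j.
(* Each track asks for [k] equalities between consecutive gap weights, hence [k + k] equations in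
   [k + k] parameters. *)
pose F (x : 'I_(k + k)) v := match fintype.split x with
  | inl i => row v i - row v i.+1
  | inr j => col v j - col v j.+1
  end.
have w_ge0 v i j : cube R _ v -> 0 <= w v i j.
  by move=> vC; apply: sumr_ge0 => t _; apply: mulr_ge0; apply: depth_ge0; exact: rates01.
have row_ge0 v i : cube R _ v -> 0 <= row v i.
  by move=> vC; apply: sumr_ge0 => j _; exact: w_ge0.
have col_ge0 v j : cube R _ v -> 0 <= col v j.
  by move=> vC; apply: sumr_ge0 => i _; exact: w_ge0.
have row0 v i : (forall t, depth (I t) (c v) i = 0) -> row v i = 0.
  by move=> h; rewrite /row big1 // => j _; rewrite /w big1 // => t _; rewrite h mul0r.
have col0 v j : (forall t, depth (J t) (d v) j = 0) -> col v j = 0.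
  by move=> h; rewrite /col big1 // => i _; rewrite /w big1 // => t _; rewrite h mulr0.
have w_cont i j : continuous (fun v => w v i j).
  apply: continuous_sum => t v; apply: (@cvgM _ _ (nbhs v) _
      (fun v => depth (I t) (c v) i) (fun v => depth (J t) (d v) j)).
    by apply: (continuous_depth (C := c)) => j'; exact: continuous_rates.
  by apply: (continuous_depth (C := d)) => j'; exact: continuous_rates.
have row_cont i : continuous (fun v => row v i).
  by apply: continuous_sum => j; exact: w_cont.
have col_cont j : continuous (fun v => col v j).
  by apply: continuous_sum => i; exact: w_cont.
have [x|x v vC vx|x v vC vx|v vC F0] := @poincare_miranda R (k + k) F.
- rewrite /F; case: fintype.split => i v /=; first exact: cvgB (row_cont i v) (row_cont i.+1 v).
  exact: cvgB (col_cont i v) (col_cont i.+1 v).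
(* A parameter 0 empties gap [i], so the difference is at most 0; on the opposite face a parameter 1
   empties gap [i.+1]. *)
- move: vx; rewrite /F -{1}(fintype.splitK x); case: fintype.split => i /= vx.
    rewrite row0 ?sub0r ?oppr_le0 ?row_ge0 // => t.
    by apply: depth_lo => //; rewrite /c rates_ord.
  rewrite col0 ?sub0r ?oppr_le0 ?col_ge0 // => t.
  by apply: depth_lo => //; rewrite /d rates_ord.
- move: vx; rewrite /F -{1}(fintype.splitK x); case: fintype.split => i /= vx.
    rewrite [X in _ - X]row0 ?subr0 ?row_ge0 // => t.
    by apply: (@depth_hi _ _ (rates01 _ vC) _ i); rewrite // /c rates_ord.
  rewrite [X in _ - X]col0 ?subr0 ?col_ge0 // => t.
  by apply: (@depth_hi _ _ (rates01 _ vC) _ i); rewrite // /d rates_ord.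
have rowS (i : 'I_k) : row v i.+1 = row v i.
  have := F0 (lshift k i); rewrite /F; case: fintype.splitP => [j ij|j /= ij]; last first.
    by have := ltn_ord i; rewrite ij ltnNge leq_addr.
  have -> : i = j by exact: ord_inj.
  by move=> /eqP; rewrite subr_eq0 => /eqP.
have colS (i : 'I_k) : col v i.+1 = col v i.
  have := F0 (rshift k i); rewrite /F; case: fintype.splitP => [j ij|j /= ij].
    by have := ltn_ord j; rewrite -ij /= ltnNge leq_addr.
  by move=> /eqP; rewrite subr_eq0 => /eqP; rewrite (ord_inj (addnI ij)).
pose s := row v 0.
have rowE i : (i < k.+1)%N -> row v i = s.
  by elim: i => // i IH ik; rewrite (rowS (Ordinal (ik : i < k)%N)) IH // ltnW.
have colE0 i : (i < k.+1)%N -> col v i = col v 0.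
  by elim: i => // i IH ik; rewrite (colS (Ordinal (ik : i < k)%N)) IH // ltnW.
(* All rows together and all columns together carry the same total weight. *)
have col_s : col v 0 = s.
  have : \sum_(i < k.+1) row v i = \sum_(j < k.+1) col v j by exact: exchange_big.
  rewrite (eq_bigr (fun=> s)) => [|i _]; last exact: rowE.
  rewrite [RHS](eq_bigr (fun=> col v 0)) => [|i _]; last exact: colE0.
  by rewrite !sumr_const card_ord => /eqP; rewrite eqrMn2r => /eqP.
have colE i : (i < k.+1)%N -> col v i = s by move=> ik; rewrite colE0.
have [s_gt0|s_le0] := ltP 0 s.
  have [i j|i|j|g ginj gE] := @balanced_matrix_perm R k (\matrix_(i, j) w v i j) s s_gt0.
  - by rewrite mxE w_ge0.
  - by rewrite -(rowE i) //; apply: eq_bigr => j _; rewrite mxE.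
  - by rewrite -(colE j) //; apply: eq_bigr => i _; rewrite mxE.
  (* A positive entry of [w] has a positive summand, which selects a member for each gap. *)
  have /choice[t tE] : forall i : 'I_k.+1, exists t,
      0 < depth (I t) (c v) i /\ 0 < depth (J t) (d v) (g i).
    move=> i; have := gE i; rewrite mxE.
    have [t /andP[h1 h2] _|h] := pickP (fun t =>
      (0 < depth (I t) (c v) i) && (0 < depth (J t) (d v) (g i))); first by exists t.
    rewrite /w big1 ?ltxx // => t _; have := h t; rewrite !lt_def !depth_ge0 ?andbT;
      try exact: rates01.
    by move/negbT; rewrite negb_and !negbK => /orP[/eqP->|/eqP->]; rewrite ?mul0r ?mulr0.
  have meet i j : I (t i) `&` I (t j) !=set0 \/ J (t i) `&` J (t j) !=set0 -> i = j.
    case=> -[y [yi yj]].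
      by apply: val_inj; apply: (depth_disjoint (rates01 _ vC) _ _ (tE i).1 (tE j).1 yi yj).
    apply: ginj; apply: val_inj.
    by apply: (depth_disjoint (rates01 _ vC) _ _ (tE i).2 (tE j).2 yi yj).
  (* A member with a nonempty trace meets itself, so [meet] also makes [t] injective. *)
  have [|i [j [/eqP ij /meet//]]] := indep (g := t).
  by move=> i j tij; apply: meet; rewrite -tij !setIid; exact: IJ0.
have w0 (i j : 'I_k.+1) t : depth (I t) (c v) i * depth (J t) (d v) j = 0.
  have : row v i = 0 by apply/eqP; rewrite eq_le row_ge0 // rowE ?s_le0.
  move/eqP; rewrite psumr_eq0 => [/allP /(_ j)|j' _]; last exact: w_ge0.
  rewrite mem_index_enum => /(_ isT) /=; rewrite psumr_eq0 => [/allP /(_ t)|t' _].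
    by rewrite mem_index_enum => /(_ isT) /= /eqP.
  by apply: mulr_ge0; apply: depth_ge0; exact: rates01.
exists (fun i : 'I_k => cut (c v) i.+1), (fun i : 'I_k => cut (d v) i.+1) => t.
(* Either all depths of [I t] vanish, or one nonzero depth forces all depths of [J t] to vanish. *)
have [/forallP h|/forallPn[i di]] :=
    boolP [forall i : 'I_k.+1, depth (I t) (c v) i == 0].
  left; have [|i ik It] := @depth_pierced R (c v) (rates01 _ vC) (I t) k (@I01 t) (rates_last _ v).
    by move=> i ik; exact: (eqP (h (Ordinal (ik : i < k.+1)%N))).
  by exists (Ordinal ik).
right; have [|j jk Jt] := @depth_pierced R (d v) (rates01 _ vC) (J t) k (@J01 t) (rates_last _ v).
  move=> j jk; have /eqP := w0 i (Ordinal (jk : j < k.+1)%N) t.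
  by rewrite mulf_eq0 (negbTE di) => /eqP.
by exists (Ordinal jk).
Qed.
End TwoTrack.

(** * Chords of the unit circle *)

Section Circle.
Variable R : realType.
Implicit Types (a b p q v w : R * R).

(** Twice the signed area of the triangle [a], [b], [q]. *)
Definition side a b q := (b.1 - a.1) * (q.2 - a.2) - (b.2 - a.2) * (q.1 - a.1).

Definition on_circle a := a.1 ^+ 2 + a.2 ^+ 2 = 1.

Lemma f_circle t : on_circle (@f R t).
Proof. by rewrite /on_circle /= sqrrN cos2Dsin2. Qed.

(** This reads the side of a chord on which a circle point lies off the order of the parameters. *)
Lemma side_f (a b t : R) : side (f a) (f b) (f t) =
  - 4 * (sin (pi * (b - a)) * sin (pi * (t - a)) * sin (pi * (t - b))).
Proof.
have dbl u : f u =
    (cos (pi * u) ^+ 2 - sin (pi * u) ^+ 2, - (2 * sin (pi * u) * cos (pi * u))) :> R * R.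
  rewrite /f (_ : 2 * pi * u = (pi * u) *+ 2) ?mulr2n -?mulr2n; last by ring.
  rewrite cos_mulr2n sin_mulr2n sin2cos2.
  by congr (_, _); ring.
rewrite !dbl !mulrBr !sinB /side /=.
have := cos2Dsin2 (pi * a); have := cos2Dsin2 (pi * b); have := cos2Dsin2 (pi * t).
move: (cos (pi * a)) (sin (pi * a)) (cos (pi * b)) (sin (pi * b)) (cos (pi * t)) (sin (pi * t)).
move=> ca sa cb sb ct st ht hb ha.
(* With each 1 of the determinant defining [side] replaced by cos^2 + sin^2, it
   is homogeneous and factors like a Vandermonde determinant. *)
pose D (na nb nt : R) :=
  let x c s := c ^+ 2 - s ^+ 2 in let y c s := - (2 * s * c) in
  na * (x cb sb * y ct st - x ct st * y cb sb) - nb * (x ca sa * y ct st - x ct st * y ca sa)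
  + nt * (x ca sa * y cb sb - x cb sb * y ca sa) : R.
transitivity (D 1 1 1); first by rewrite /D; ring.
have -> : D 1 1 1 = D (ca ^+ 2 + sa ^+ 2) (cb ^+ 2 + sb ^+ 2) (ct ^+ 2 + st ^+ 2).
  by rewrite ha hb ht.
by rewrite /D; ring.
Qed.

Lemma convE a b (t : R) : (1 - t) *: a + t *: b =
  ((1 - t) * a.1 + t * b.1, (1 - t) * a.2 + t * b.2).
Proof. by []. Qed.

Lemma segment_side0 a b q : segment a b q -> side a b q = 0.
Proof. by case=> t _ <-; rewrite convE /side /=; ring. Qed.

(** Write [p = a + l (b - a)]. Then [l (l - 1) D] is the squared norm of [p] minus 1, hence
    negative, which puts [l] between 0 and 1. *)
Lemma side0_segment a b p : on_circle a -> on_circle b -> open_disk R p ->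
  a != b -> side a b p = 0 -> segment a b p.
Proof.
case: a b p => [a1 a2] [b1 b2] [p1 p2]; rewrite /on_circle /open_disk /side /= => ha hb hp ab h0.
pose d1 := b1 - a1; pose d2 := b2 - a2; pose D := d1 ^+ 2 + d2 ^+ 2.
have D0 : 0 < D.
  rewrite lt_def addr_ge0 ?sqr_ge0 // andbT paddr_eq0 ?sqr_ge0 // !sqrf_eq0 !subr_eq0.
  by apply: contra ab => /andP[/eqP-> /eqP->].
pose l := ((p1 - a1) * d1 + (p2 - a2) * d2) / D.
have lD : l * D = (p1 - a1) * d1 + (p2 - a2) * d2 by rewrite /l divfK // gt_eqF.
have e1 : p1 = a1 + l * d1.
  apply/eqP; rewrite -subr_eq0 -(mulIr_eq0 _ (mulIf (lt0r_neq0 D0))); apply/eqP.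
  have -> : (p1 - (a1 + l * d1)) * D = (p1 - a1) * D - d1 * (l * D) by ring.
  by rewrite lD -[RHS](mulr0 (- d2)) -h0 /D /d1 /d2; ring.
have e2 : p2 = a2 + l * d2.
  apply/eqP; rewrite -subr_eq0 -(mulIr_eq0 _ (mulIf (lt0r_neq0 D0))); apply/eqP.
  have -> : (p2 - (a2 + l * d2)) * D = (p2 - a2) * D - d2 * (l * D) by ring.
  by rewrite lD -[RHS](mulr0 d1) -h0 /D /d1 /d2; ring.
have hd : 2 * (a1 * d1 + a2 * d2) + D = 0.
  have -> : 0 = b1 ^+ 2 + b2 ^+ 2 - (a1 ^+ 2 + a2 ^+ 2) :> R by rewrite ha hb subrr.
  by rewrite /D /d1 /d2; ring.
have hl : l * (l - 1) * D < 0.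
  suff -> : l * (l - 1) * D = p1 ^+ 2 + p2 ^+ 2 - (a1 ^+ 2 + a2 ^+ 2).
    by rewrite ha subr_lt0.
  rewrite e1 e2.
  suff -> : l * (l - 1) * D = l * (2 * (a1 * d1 + a2 * d2)) + l ^+ 2 * D by rewrite /D; ring.
  by rewrite (_ : 2 * (a1 * d1 + a2 * d2) = - D); [ring|lra].
have hl' : l * (l - 1) < 0 by rewrite -(pmulr_llt0 _ D0).
exists l => /=; first by rewrite in_itv /=; apply/andP; nra.
by rewrite convE e1 e2 /d1 /d2; congr (_, _) => /=; ring.
Qed.

(** For [a = b] the function [side] is identically 0, while the segment is a single circle point
    outside the open disk. *)
Lemma side_segment a b p : on_circle a -> on_circle b -> open_disk R p ->
  segment a b p <-> a != b /\ side a b p = 0.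
Proof.
move=> ha hb hp; split=> [s|[]]; last exact: side0_segment.
split; last exact: segment_side0.
apply/eqP => ab; case: s hp => t _ <-; rewrite ab -scalerDl subrK scale1r.
by rewrite /open_disk /= (hb : _ = _) ltxx.
Qed.

(** The witness is the positive root of the quadratic equation in [s]; [E] is its reduced
    discriminant. *)
Lemma exit_point p v : open_disk R p -> v != 0 ->
  exists2 s, 0 < s & on_circle (p + s *: v).
Proof.
case: p v => [p1 p2] [v1 v2]; rewrite /open_disk /on_circle /= => hp v0.
pose D := v1 ^+ 2 + v2 ^+ 2; pose B := p1 * v1 + p2 * v2.
have D0 : 0 < D.
  rewrite lt_def addr_ge0 ?sqr_ge0 // andbT paddr_eq0 ?sqr_ge0 // !sqrf_eq0.
  by apply: contra v0 => /andP[/eqP-> /eqP->].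
pose E := B ^+ 2 + D * (1 - (p1 ^+ 2 + p2 ^+ 2)).
have E0 : B ^+ 2 < E by rewrite ltrDl mulr_gt0 // subr_gt0.
have E0' : 0 <= E by rewrite (le_trans (sqr_ge0 B)) // ltW.
pose r := Num.sqrt E; have rE : r ^+ 2 = E by rewrite sqr_sqrtr.
have r0 : 0 <= r by rewrite sqrtr_ge0.
have rB : 0 < r - B by nra.
exists ((r - B) / D); first by rewrite divr_gt0.
set s := (r - B) / D; have sD : s * D = r - B by rewrite /s divfK // gt_eqF.
apply: (mulfI (lt0r_neq0 D0)).
have -> : D * ((p1 + s * v1) ^+ 2 + (p2 + s * v2) ^+ 2) =
  D * (p1 ^+ 2 + p2 ^+ 2) + 2 * (s * D) * B + (s * D) ^+ 2 by rewrite /D /B; ring.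
rewrite sD (_ : (r - B) ^+ 2 = r ^+ 2 - 2 * r * B + B ^+ 2); last by ring.
by rewrite rE /E; ring.
Qed.

(** [f] runs clockwise from [(1, 0)], so [acos q1 / (2 * pi)] serves the lower half circle and its
    complement to 1 the upper half. *)
Lemma f_surj q : on_circle q -> exists2 t, 0 <= t < 1 & f t = q.
Proof.
case: q => [q1 q2]; rewrite /on_circle /= => hq.
have q11 : -1 <= q1 <= 1 by apply/andP; nra.
have pi0 := pi_gt0 R; have pi2 : 0 < 2 * pi :> R by lra.
have cosE : cos (acos q1) = q1 by rewrite acosK // in_itv.
have sinE : sin (acos q1) = `|q2| by rewrite sin_acos // -hq addrAC subrr add0r sqrtr_sqr.
have a0 := acos_ge0 q11; have a1 := acos_lepi q11.
have [q20|q20] := leP q2 0.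
  exists (acos q1 / (2 * pi)).
    by rewrite divr_ge0 ?(ltW pi2) //= ltr_pdivrMr // mul1r; lra.
  by rewrite /f mulrC divfK ?gt_eqF // cosE sinE ler0_norm ?opprK.
have q1lt : q1 < 1 by nra.
have a2 : 0 < acos q1 by apply: acos_gt0; lra.
exists (1 - acos q1 / (2 * pi)).
  have : acos q1 / (2 * pi) <= 1 by rewrite ler_pdivrMr // mul1r; lra.
  have : 0 < acos q1 / (2 * pi) by rewrite divr_gt0.
  by lra.
have -> : @f R (1 - acos q1 / (2 * pi)) = (cos (- acos q1 + pi *+ 2), - sin (- acos q1 + pi *+ 2)).
  rewrite /f (_ : 2 * pi * (1 - acos q1 / (2 * pi)) = - acos q1 + pi *+ 2) //.
  by rewrite mulrBr mulr1 [_ * (_ / _)]mulrC divfK ?gt_eqF // mulr2n; ring.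
by rewrite cosD2pi sinD2pi cosN sinN opprK cosE sinE gtr0_norm.
Qed.

(** A vector along the first chord annihilates the first product, and its sign is chosen for the
    second. If the first chord is degenerate, the second chord gives the direction. *)
Lemma common_direction a1 b1 a2 b2 (g1 g2 : R) : exists2 v : R * R, v != 0 &
  0 <= g1 * ((b1.1 - a1.1) * v.2 - (b1.2 - a1.2) * v.1) /\
  0 <= g2 * ((b2.1 - a2.1) * v.2 - (b2.2 - a2.2) * v.1).
Proof.
have par (d : R * R) (g : R) : 0 <= g * (d.1 * d.2 - d.2 * d.1).
  by rewrite [d.1 * _]mulrC subrr mulr0.
have par0 (v : R * R) (g : R) : 0 <= g * (0 * v.2 - 0 * v.1).
  by rewrite !mul0r subrr mulr0.
have [e1|d1] := eqVneq b1 a1; last first.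
  have d0 : b1 - a1 != 0 by rewrite subr_eq0.
  have [h|h] := leP 0 (g2 * ((b2.1 - a2.1) * (b1 - a1).2 - (b2.2 - a2.2) * (b1 - a1).1)).
    by exists (b1 - a1) => //; split=> //; exact: (par (b1 - a1)).
  exists (- (b1 - a1)); first by rewrite oppr_eq0.
  split; last by move: h => /=; nra.
  by have /= := par (b1 - a1) (- g1); nra.
rewrite e1 !subrr; have [e2|d2] := eqVneq b2 a2.
  exists (1, 0); last by rewrite e2 !subrr; split; exact: par0.
  by apply/eqP => /(congr1 fst) /= /eqP; rewrite oner_eq0.
by exists (b2 - a2); [rewrite subr_eq0|split; [exact: par0|exact: (par (b2 - a2))]].
Qed.
End Circle.

(** * The pieces of the disk *)

Section Plane.
Variable R : realType.
Implicit Types (a b p q v w : R * R) (A : set (R * R)) (x : 'rV[R]_4).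

Definition segpt a b (t : R) : R * R := (1 - t) *: a + t *: b.

Lemma continuous_segpt a b : continuous (segpt a b).
Proof.
have aff (y z : R) : continuous (fun t : R => (1 - t) * y + t * z).
  move=> t; apply: cvgD; apply: cvgM; try exact: cvg_cst; try exact: cvg_id.
  by apply: cvgB; [exact: cvg_cst|exact: cvg_id].
by move=> t; exact: cvg_pair (aff a.1 b.1 t) (aff a.2 b.2 t).
Qed.

Lemma segpt0 a b : segpt a b 0 = a.
Proof. by rewrite /segpt subr0 scale1r scale0r addr0. Qed.

Lemma segpt1 a b : segpt a b 1 = b.
Proof. by rewrite /segpt subrr scale1r scale0r add0r. Qed.

Lemma segpt_component A a b (s : R) : 0 <= s -> (forall t, 0 <= t <= s -> A (segpt a b t)) ->
  connected_component A a (segpt a b s).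
Proof.
move=> s0 h; apply: (@connected_component_max _ A (segpt a b @` `[0, s]) a).
- by exists 0; [rewrite /= in_itv /= lexx|rewrite segpt0].
- by move=> _ [t /= ts <-]; apply: h; move: ts; rewrite in_itv.
- apply: connected_continuous_connected; first exact: segment_connected.
  exact/continuous_subspaceT/continuous_segpt.
- by exists s => //; rewrite /= in_itv /= s0 lexx.
Qed.

Lemma convex_segpt A a b t : convex_set A -> A a -> A b -> 0 <= t <= 1 -> A (segpt a b t).
Proof.
move=> cA Aa Ab t01.
have := cA b a (Itv01 (andP t01).1 (andP t01).2).
rewrite !in_setE => /(_ Ab Aa).
by rewrite /segpt addrC.
Qed.

Lemma segpt_closure_component A a b : (forall t, 0 <= t < 1 -> A (segpt a b t)) ->
  closure (connected_component A a) b.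
Proof.
move=> h B; rewrite -{1}(segpt1 a b) => /(continuous_segpt) /nbhs_ballP[e /= e0 He].
pose s := Num.max 0 (1 - e / 2).
have s01 : 0 <= s < 1 by rewrite /s le_max lexx /= gt_max ltr01 /=; lra.
exists (segpt a b s); split.
  apply: segpt_component => [|t ts]; first by lra.
  by apply: h; lra.
apply: He; rewrite /ball /= ger0_norm; last by lra.
have : 1 - e / 2 <= s by rewrite /s le_max lexx orbT.
by lra.
Qed.

Lemma segpt_disk p q t : open_disk R p -> on_circle q -> 0 <= t < 1 -> open_disk R (segpt p q t).
Proof.
case: p q => [p1 p2] [q1 q2]; rewrite /open_disk /on_circle /segpt /= => hp hq t01.
have e1 : 2 * (p1 * q1) <= p1 ^+ 2 + q1 ^+ 2 by have := sqr_ge0 (p1 - q1); lra.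
have e2 : 2 * (p2 * q2) <= p2 ^+ 2 + q2 ^+ 2 by have := sqr_ge0 (p2 - q2); lra.
change (((1 - t) * p1 + t * q1) ^+ 2 + ((1 - t) * p2 + t * q2) ^+ 2 < 1).
have -> : ((1 - t) * p1 + t * q1) ^+ 2 + ((1 - t) * p2 + t * q2) ^+ 2 =
  (1 - t) ^+ 2 * (p1 ^+ 2 + p2 ^+ 2) + (1 - t) * t * (2 * (p1 * q1) + 2 * (p2 * q2))
  + t ^+ 2 * (q1 ^+ 2 + q2 ^+ 2) by ring.
rewrite hq.
have h1 : (1 - t) * t * (2 * (p1 * q1) + 2 * (p2 * q2)) <=
          (1 - t) * t * (p1 ^+ 2 + p2 ^+ 2 + 1).
  by apply: ler_wpM2l; [nra|lra].
have h2 : (1 - t) * (p1 ^+ 2 + p2 ^+ 2) < (1 - t) * 1.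
  by rewrite ltr_pM2l; lra.
nra.
Qed.

Lemma side_segpt a b p q t : side a b (segpt p q t) = (1 - t) * side a b p + t * side a b q.
Proof. by rewrite /segpt convE /side /=; ring. Qed.

Lemma f0E : f 0 = (1, 0) :> R * R.
Proof. by rewrite /f mulr0 cos0 sin0 oppr0. Qed.

Lemma psum0 x : psum x 0 = 0.
Proof. by rewrite /psum big_pred0. Qed.

Lemma psumS x (i : 'I_4) : psum x i.+1 = psum x i + x 0 i.
Proof.
rewrite /psum (bigD1 i) //= addrC; congr (_ + _); apply: eq_bigl => j.
by rewrite ltnS leq_eqVlt andb_orl andbN /= -val_eqE /= neq_ltn; case: (ltngtP j i).
Qed.

Lemma psum4 x : simplex R x -> psum x 4 = 1.
Proof. by case=> _ <-; apply: eq_bigl => j; rewrite ltn_ord. Qed.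

Lemma psum_le x m n : simplex R x -> (m <= n)%N -> (n <= 4)%N -> psum x m <= psum x n.
Proof.
move=> [x0 _] mn n4; rewrite /psum big_mkcond [leRHS]big_mkcond /=; apply: ler_sum => j _.
by case: ifP => [jm|]; [rewrite (leq_trans jm)|case: ifP].
Qed.

Lemma sin_pi_prod (a t u : R) : 0 <= a <= 1 -> 0 <= t <= 1 -> 0 <= u <= 1 ->
  (a <= t /\ a <= u) \/ (t <= a /\ u <= a) ->
  0 <= sin (pi * (t - a)) * sin (pi * (u - a)).
Proof.
have pos (z : R) : 0 <= z <= 1 -> 0 <= sin (pi * z).
  move=> z01; apply: sin_ge0_pi; have := pi_gt0 R => pi0.
  by rewrite mulr_ge0 ?(ltW pi0) ?ler_piMr ?(ltW pi0) //; lra.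
move=> a01 t01 u01 [[at_ au]|[ta ua]]; first by apply: mulr_ge0; apply: pos; lra.
rewrite -(opprB a t) -(opprB a u) !mulrN !sinN mulrNN.
by apply: mulr_ge0; apply: pos; lra.
Qed.

(** No breakpoint lies strictly between [t] and [u], so each sine factor of [side_f] that varies has
    the same weak sign at both. *)
Lemma side_same_arc x (i : 'I_4) (m m' : nat) (t u : R) : simplex R x ->
  (m < 4)%N -> (m' < 4)%N ->
  psum x i <= t <= psum x i.+1 -> psum x i <= u <= psum x i.+1 ->
  0 <= side (f (psum x m)) (f (psum x m')) (f t) * side (f (psum x m)) (f (psum x m')) (f u).
Proof.
move=> xS m4 m'4 ht hu; rewrite !side_f.
have bd n : (n <= 4)%N -> 0 <= psum x n <= 1.
  by move=> n4; rewrite -{1}(psum0 x) -(psum4 xS) !psum_le.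
have [i0 _] := andP (bd i (ltnW (ltn_ord i))); have [_ i1] := andP (bd i.+1 (ltn_ord i)).
have prod n : (n < 4)%N -> 0 <= sin (pi * (t - psum x n)) * sin (pi * (u - psum x n)).
  move=> n4; apply: sin_pi_prod; [exact: bd (ltnW n4)|lra|lra|].
  have [ni|ni] := leqP n i; [left|right].
    by have := psum_le xS ni (ltnW (ltn_ord i)); lra.
  by have := psum_le xS ni (ltnW n4); lra.
have h1 := prod m m4; have h2 := prod m' m'4.
set c := sin (pi * (psum x m' - psum x m)).
move: h1 h2; set A := sin _; set B := sin _; set A' := sin _; set B' := sin _ => h1 h2.
have -> : - 4 * (c * A * A') * (- 4 * (c * B * B')) = 16 * c ^+ 2 * ((A * B) * (A' * B')) by ring.
by apply: mulr_ge0; [rewrite mulr_ge0 ?sqr_ge0 ?ler0n|exact: mulr_ge0].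
Qed.

(* A ray from p that is parallel to one chord and does not approach the other
   one leaves the disk in an arc of positive length, on the same side of both
   chords as p. The segments from p to the points of this arc avoid the chords. *)
Lemma region_cover x p : simplex R x -> (open_disk R `\` chords x) p ->
  exists i, region x i p.
Proof.
move=> xS [pD pC].
pose s := psum x; have s0 : s 0%N = 0 := psum0 x; have s4 : s 4%N = 1 := psum4 xS.
pose S1 := side (f (s 0%N)) (f (s 2)); pose S2 := side (f (s 1%N)) (f (s 3)).
have chordsE q : open_disk R q -> chords x q <->
    (f (s 0%N) != f (s 2) /\ S1 q = 0) \/ (f (s 1%N) != f (s 3) /\ S2 q = 0).
  move=> qD; have -> : chords x = segment (f (s 0%N)) (f (s 2)) `|` segment (f (s 1%N)) (f (s 3)).
    by rewrite s0 f0E.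
  have h1 := side_segment (f_circle (s 0%N)) (f_circle (s 2)) qD.
  have h2 := side_segment (f_circle (s 1%N)) (f_circle (s 3)) qD.
  by split; (case; [move/h1; left|move/h2; right]).
have [v v0 [v1 v2]] := common_direction (f (s 0%N)) (f (s 2)) (f (s 1%N)) (f (s 3)) (S1 p) (S2 p).
have [r r0 rC] := exit_point pD v0.
have [t t01 tE] := f_surj rC.
(* These half-open intervals tile [[0, 1)], so the chosen arc has positive length, as [region]
   requires. *)
have [i it] : exists i : 'I_4, s i <= t < s i.+1.
  have [h1|h1] := ltP t (s 1%N).
    by exists (inord 0); rewrite inordK // s0 h1; lra.
  have [h2|h2] := ltP t (s 2); first by exists (inord 1); rewrite inordK // h1 h2.
  have [h3|h3] := ltP t (s 3); first by exists (inord 2); rewrite inordK // h2 h3.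
  by exists (inord 3); rewrite inordK // h3 s4; lra.
(* Along the ray [side] keeps its sign and does not decrease in absolute value. *)
have St (a b : R * R) : 0 <= side a b p * ((b.1 - a.1) * v.2 - (b.2 - a.2) * v.1) ->
    side a b p ^+ 2 <= side a b p * side a b (f t).
  rewrite tE => h.
  have -> : side a b (p + r *: v) = side a b p + r * ((b.1 - a.1) * v.2 - (b.2 - a.2) * v.1).
    by rewrite /side /= /GRing.scale /=; ring.
  by nra.
exists i; split=> //.
  by rewrite -(ltrD2l (psum x i)) addr0 -psumS; move: it; rewrite /s; lra.
move=> _ [u /= + <-]; rewrite in_itv /= => uI.
(* The sign passes from [p] to the exit point [f t], and from there along the arc to [f u]. *)
have same (m m' : nat) : (m < 4)%N -> (m' < 4)%N ->
    side (f (s m)) (f (s m')) p ^+ 2 <=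
      side (f (s m)) (f (s m')) p * side (f (s m)) (f (s m')) (f t) ->
    0 <= side (f (s m)) (f (s m')) p * side (f (s m)) (f (s m')) (f u).
  move=> m4 m'4 h; have : 0 <= side (f (s m)) (f (s m')) (f t) * side (f (s m)) (f (s m')) (f u).
    by apply: (@side_same_arc x i) => //; move: it; rewrite /s; lra.
  move: h; set X := side _ _ p; set Y := side _ _ (f t); set Z := side _ _ (f u) => h1 h2.
  have [->|X0] := eqVneq X 0; first by rewrite mul0r.
  have XY : 0 < X * Y by apply: lt_le_trans h1; rewrite exprn_even_gt0.
  have Y2 : 0 < Y ^+ 2.
    by rewrite exprn_even_gt0 //=; apply: contraTneq XY => ->; rewrite mulr0 ltxx.
  rewrite -(pmulr_rge0 _ Y2); have -> : Y ^+ 2 * (X * Z) = (X * Y) * (Y * Z) by ring.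
  by rewrite mulr_ge0 // ltW.
have h1 := same 0%N 2%N isT isT (St _ _ v1).
have h2 := same 1%N 3%N isT isT (St _ _ v2).
apply: segpt_closure_component => z z01.
have zD := segpt_disk pD (f_circle u) z01.
split=> //; move/(chordsE _ zD); have {}pC := contra_not (chordsE _ pD).2 pC.
(* Since [z < 1], the nonzero value [X] keeps a positive weight and [Z] cannot cancel it. *)
have nz (X Z : R) : X != 0 -> 0 <= X * Z -> (1 - z) * X + z * Z != 0.
  move=> X0 XZ; apply/eqP => e.
  have X2 : 0 < X ^+ 2 by rewrite exprn_even_gt0.
  have : (1 - z) * X ^+ 2 + z * (X * Z) = X * ((1 - z) * X + z * Z) by ring.
  by rewrite e mulr0; nra.
case=> -[ne]; rewrite /S1 /S2 side_segpt; apply/eqP; apply: nz => //.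
  by apply/eqP => e; apply: pC; left.
by apply/eqP => e; apply: pC; right.
Qed.
End Plane.

(** * Piercing the family *)

Definition chord_trace (R : realType) (a b : R * R) (X : set (R * R)) : set R :=
  [set t | 0 <= t <= 1 /\ X (segpt a b t)].

Lemma compact_chord_trace (R : realType) (a b : R * R) (X : set (R * R)) :
  compact X -> compact (chord_trace a b X).
Proof.
move=> cX.
have -> : chord_trace a b X = `[0, 1]%classic `&` (segpt a b @^-1` X).
  by apply/seteqP; split=> t; rewrite /chord_trace /= in_itv.
apply: compact_closedI; first exact: segment_compact.
apply: closed_comp => [t _|]; first exact: continuous_segpt.
by apply: compact_closed => //; exact: norm_hausdorff.
Qed.

(** Compactness gives extreme parameters and convexity fills in between. The ends of the chord lie
    on the circle, hence outside [X], which makes the bounds strict. *)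
Lemma segment01_chord_trace (R : realType) (a b : R * R) (X : set (R * R)) :
  on_circle a -> on_circle b -> compact X -> convex_set X -> X `<=` open_disk R ->
  segment01 (chord_trace a b X).
Proof.
move=> ha hb cX vX XD tr0; have cT := compact_chord_trace (a := a) (b := b) cX.
have idc : {within chord_trace a b X, continuous (idfun : R -> R)}.
  by apply: continuous_subspaceT => t; exact: cvg_id.
have [M + Mmax] := compact_EVT_max tr0 cT idc.
have [m + mmin] := compact_EVT_min tr0 cT idc.
rewrite !in_setE => hm hM.
have mlb : lbound (chord_trace a b X) m by move=> t ht; apply: mmin; rewrite in_setE.
have Mub : ubound (chord_trace a b X) M by move=> t ht; apply: Mmax; rewrite in_setE.
have -> : inf (chord_trace a b X) = m.
  by apply/eqP; rewrite eq_le ge_inf //= ?lb_le_inf //; exists m.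
have -> : sup (chord_trace a b X) = M.
  by apply/eqP; rewrite eq_le ub_le_sup ?ge_sup //; exists M.
have [m01 Xm] := hm; have [M01 XM] := hM.
have notdisk (c : R * R) : on_circle c -> ~ X c.
  by move=> hc /XD; rewrite /open_disk /= (hc : _ = _) ltxx.
have m0 : m != 0 by apply/eqP => e; move: Xm; rewrite e segpt0; exact: notdisk.
have M1 : M != 1 by apply/eqP => e; move: XM; rewrite e segpt1; exact: notdisk.
split; [by rewrite lt_def m0; lra|by rewrite lt_neqAle M1; lra|move=> y].
split=> [hy|/andP[my yM]]; first by rewrite (mlb _ hy) (Mub _ hy).
have [mM|mM] := eqVneq m M; first by have -> : y = m by lra.
have d0 : 0 < M - m by rewrite subr_gt0 lt_neqAle mM (le_trans my).
split; first by lra.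
have -> : segpt a b y = segpt (segpt a b m) (segpt a b M) ((y - m) / (M - m)).
  have e : y = m + (y - m) / (M - m) * (M - m) by rewrite divfK ?gt_eqF //; ring.
  move: e; set z := (y - m) / (M - m) => e.
  by rewrite [in LHS]e /segpt !convE /=; congr (_, _); ring.
apply: convex_segpt => //; apply/andP; split; first by apply: divr_ge0; lra.
by rewrite ler_pdivrMr // mul1r; lra.
Qed.

Lemma card_seq (T : choiceType) (s : seq T) : uniq s -> ([set` s] #= `I_(size s))%card.
Proof.
case: s => [|x0 s' us]; first by rewrite set_nil /= II0 card_eq00.
set s := x0 :: s'.
have -> : [set` s] = nth x0 s @` `I_(size s).
  apply/seteqP; split=> [y /= ys|_ [i /= ilt <-]]; last exact: mem_nth.
  by exists (index y s); [move: ys; rewrite -index_mem|rewrite nth_index].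
apply: inj_card_eq => i j; rewrite !in_setE => /= ilt jlt /eqP.
by rewrite nth_uniq // => /eqP.
Qed.

Lemma tau_le (R : realType) (T : choiceType) (C : set (set T)) (P : seq T) (n : nat) :
  (size P <= n)%N -> pierces [set` P] C -> (tau R C <= n%:R%:E)%E.
Proof.
(* [tau] counts points by exact cardinality, so repetitions in [P] are removed. *)
move=> Pn hP; apply: ge_ereal_inf; exists (size (undup P))%:R%:E.
  exists (size (undup P)) => //; exists [set` P] => //.
  rewrite (_ : [set` P] = [set` undup P]) ?card_seq ?undup_uniq //.
  by apply/seteqP; split=> y /=; rewrite mem_undup.
by rewrite lee_fin ler_nat (leq_trans (size_undup P)).
Qed.

Section Family.
Variables (R : realType) (C : set (set (R * R))) (x : 'rV[R]_4).
Hypothesis C_convex : forall X, C X -> convex_set X.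
Hypothesis C_disk : forall X, C X -> X `<=` open_disk R.
Hypothesis C_43 : pq_property 4 3 C.
Hypothesis xS : simplex R x.
Hypothesis xA : ~ (\bigcup_i A_set C i) x.

Lemma convex_region (X Y : set (R * R)) (p : R * R) (i : 'I_4) : C X -> C Y ->
  ~ (X `&` Y `&` chords x !=set0) -> X p -> Y p -> region x i p ->
  X `&` Y `<=` region x i.
Proof.
move=> CX CY ch Xp Yp [xi _ arcp] q [Xq Yq].
have XYD r : X r -> Y r -> (open_disk R `\` chords x) r.
  by move=> Xr Yr; split; [exact: C_disk Xr|move=> cr; apply: ch; exists r].
have cpq : connected_component (open_disk R `\` chords x) p q.
  rewrite -(segpt1 p q); apply: segpt_component => // t t01.
  by apply: XYD; apply: convex_segpt => //; exact: C_convex.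
by split=> //; [exact: XYD|rewrite -(same_connected_component cpq)].
Qed.

(** Otherwise the pairwise intersections of the three members through [p] all lie in the region of
    [p], which puts [x] in some [A_set C i]. *)
Lemma four_meet_chords (l : seq (set (R * R))) : uniq l -> size l = 4%N ->
  {in l, forall X, C X} ->
  exists X Y, [/\ X \in l, Y \in l, X != Y & X `&` Y `&` chords x !=set0].
Proof.
move=> ul sl lC.
have [||E [EC E3 [p pE]]] := C_43 (D := [set` l]).
- by move=> X /= /lC.
- by rewrite -sl; exact: card_seq.
have /card_set_bijP[g [gE ginj _]] := card_esym E3.
have gX i : (i < 3)%N -> g i \in l /\ g i p.
  by move=> i3; have Egi := gE i i3; split; [exact: EC|exact: pE].
have gne i j : (i < 3)%N -> (j < 3)%N -> i != j -> g i != g j.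
  by move=> i3 j3; apply: contra => /eqP /ginj; rewrite !in_setE => /(_ i3 j3) ->.
have [l0 p0] := gX 0%N isT; have [l1 p1] := gX 1%N isT; have [l2 p2] := gX 2%N isT.
apply: contrapT => h.
have nch i j : (i < 3)%N -> (j < 3)%N -> i != j -> ~ (g i `&` g j `&` chords x !=set0).
  move=> i3 j3 ij ne; apply: h; exists (g i), (g j).
  by split; rewrite ?gne //; [exact: (gX i i3).1|exact: (gX j j3).1].
have [i pi_] : exists i, region x i p.
  apply: region_cover => //; split; first exact: C_disk (lC _ l0) _ p0.
  by move=> pc; apply: (nch 0%N 1%N) => //; exists p.
apply: xA; exists i => //; split=> //; exists (g 0%N), (g 1%N), (g 2); split.
- by split; exact: lC.
- by split; apply/eqP; exact: gne.
- by exists p.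
- by split; apply: (@convex_region _ _ p) => //; try exact: lC; exact: nch.
Qed.
End Family.

Theorem theorem4 (R : realType) (C : set (set (R * R)))
  (C_finite : finite_set C) (C_card : (`I_4 #<= C)%card)
  (C_nonempty : forall X, C X -> X !=set0)
  (C_compact : forall X, C X -> compact X)
  (C_convex : forall X, C X -> convex_set X)
  (C_disk : forall X, C X -> X `<=` open_disk R)
  (C_43 : pq_property 4 3 C)
  (x_exists : exists x, (simplex R `\` \bigcup_i A_set C i) x) :
  (tau R C <= 8%:R%:E)%E.
Proof.
have [x [xS xA]] := x_exists.
have meet := four_meet_chords C_convex C_disk C_43 xS xA.
have /finite_seqP[s0 Cs0] := C_finite; pose s := undup s0.
have us : uniq s := undup_uniq s0.
have Cs X : X \in s -> C X by rewrite Cs0 /s mem_undup.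
pose a1 : R * R := (1, 0); pose b1 := f (psum x 2).
pose a2 := f (psum x 1); pose b2 := f (psum x 3).
have ha1 : on_circle a1 by rewrite /on_circle /= expr1n expr0n addr0.
pose I X := chord_trace a1 b1 X; pose J X := chord_trace a2 b2 X.
have IJ X Y : X `&` Y `&` chords x !=set0 -> I X `&` I Y !=set0 \/ J X `&` J Y !=set0.
  case=> q [[Xq Yq] [[t t01 tq]|[t t01 tq]]]; rewrite /= in_itv /= in t01; subst q;
    [left|right]; by exists t.
pose isol X := (I X == set0) && (J X == set0).
pose s1 := [seq X <- s | isol X]; pose s2 := [seq X <- s | ~~ isol X].
have isolN X Y : isol X -> ~ (X `&` Y `&` chords x !=set0).
  by move=> /andP[/eqP hI /eqP hJ] /IJ; rewrite hI hJ !set0I => -[] [].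
(* Among four isolated members two would meet on a chord. *)
have size1 : (size s1 <= 3)%N.
  rewrite leqNgt; apply/negP => s14.
  have [||X|X [Y [Xl Yl XneY XY]]] := meet (take 4 s1).
  - exact/take_uniq/filter_uniq.
  - by rewrite size_takel.
  - by move=> /mem_take; rewrite mem_filter => /andP[_ /Cs].
  - move: Xl => /mem_take; rewrite mem_filter => /andP[iX _].
    exact: isolN iX XY.
pose k := (3 - size s1)%N.
pose T := 'I_(size s2); pose X (t : T) := nth set0 s2 t.
have Xs2 t : X t \in s2 by exact: mem_nth.
have XC t : C (X t) by have := Xs2 t; rewrite mem_filter => /andP[_ /Cs].
have Xinj : injective X.
  move=> t u /eqP; rewrite nth_uniq ?filter_uniq //; first by move/eqP/val_inj.
have [||t|g ginj|p [q pq]] := @two_track R k T (I \o X) (J \o X).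
- move=> t; apply: segment01_chord_trace;
    [exact: ha1|exact: f_circle|exact: C_compact|exact: C_convex|exact: C_disk].
- move=> t; apply: segment01_chord_trace;
    [exact: f_circle|exact: f_circle|exact: C_compact|exact: C_convex|exact: C_disk].
- have := Xs2 t; rewrite mem_filter negb_and => /andP[/orP[/set0P|/set0P] ? _]; by [left|right].
(* The isolated members and the [k.+1] selected ones are four in all, so two of them meet on a
   chord, and neither of these is isolated. *)
- pose l := s1 ++ [seq X (g i) | i <- enum 'I_k.+1].
  have memr Y : Y \in [seq X (g i) | i <- enum 'I_k.+1] -> exists i, Y = X (g i).
    by case/mapP => i _ ->; exists i.
  have [|||A [B [Al Bl AB ABc]]] := meet l.
  + rewrite cat_uniq filter_uniq //= map_inj_uniq ?enum_uniq ?andbT; last first.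
      by move=> i j /Xinj/ginj.
    apply/hasPn => Y /memr[i ->]; have := Xs2 (g i).
    by rewrite !mem_filter => /andP[/negbTE->].
  + by rewrite size_cat size_map size_enum_ord /k addnS subnKC.
  + move=> Y; rewrite mem_cat => /orP[|/memr[i ->] //].
    by rewrite mem_filter => /andP[_ /Cs].
  move: Al Bl; rewrite !mem_cat !mem_filter.
  case/orP => [/andP[iA _]|/memr[i Ai]]; first by case: (isolN _ _ iA ABc).
  case/orP => [/andP[iB _]|/memr[j Bj]].
    by case: (isolN B A iB); rewrite [B `&` A]setIC.
  exists i, j; split; last by rewrite /= -Ai -Bj; exact: IJ.
  by apply: contra AB => /eqP ij; rewrite Ai Bj ij.
have /choice[pt ptE] : forall Y : set (R * R), exists y, Y !=set0 -> Y y.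
  by move=> Y; have [->|/set0P[y Yy]] := eqVneq Y set0; [exists (0, 0) => -[]|exists y].
pose P := [seq pt Y | Y <- s1] ++ [seq segpt a1 b1 (p i) | i <- enum 'I_k]
  ++ [seq segpt a2 b2 (q i) | i <- enum 'I_k].
apply: (@tau_le _ _ _ P).
  (* The isolated members and the first chord use [size s1 + k = 3] points, and the second chord at
     most 3 more. *)
  rewrite !size_cat !size_map -!enumT !size_enum_ord.
  by rewrite addnA /k subnKC // (leq_trans (leq_add (leqnn 3) (leq_subr _ _))).
move=> Y CY.
have Ys : Y \in s by rewrite mem_undup; move: CY; rewrite Cs0.
have [iY|iY] := boolP (isol Y).
  exists (pt Y); split; first by apply: ptE; exact: C_nonempty.
  by rewrite /= mem_cat map_f // mem_filter iY.
have Ys2 : Y \in s2 by rewrite mem_filter iY.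
have ylt : (index Y s2 < size s2)%N by rewrite index_mem.
have XY : X (Ordinal ylt) = Y by rewrite /X /= nth_index.
case: (pq (Ordinal ylt)) => -[i]; rewrite /= XY => -[_ Yi].
  exists (segpt a1 b1 (p i)); split=> //=.
  by rewrite !mem_cat (map_f (fun i => segpt a1 b1 (p i))) ?mem_enum ?orbT.
exists (segpt a2 b2 (q i)); split=> //=.
by rewrite !mem_cat (map_f (fun i => segpt a2 b2 (q i))) ?mem_enum ?orbT.
Qed.
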